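(* Let $p>1$ be a real number and let $\mu,\nu$ be two positive measures on $\mathbb{N}^*$. Let $F^0(\mathbb{N}^* )$ be the set of functions $f:\mathbb{N}^*\to\mathbb{R}$ such that $\sum_{n=1}^\infty f(n)=0$, and let $C^0_{\mu,\nu}\in(0,+\infty]$ be the smallest constant such that $$\sum_{x\in\mathbb{N}^*}\left|\sum_{y=1}^{x}f(y)\right|^p\mu(x)\le C^0_{\mu,\nu}\sum_{x\in\mathbb{N}^*}|f(x)|^p\,\nu(x)\qquad\text{for all } f\in F^0(\mathbb{N}^* ).$$ Let $$B^{(1)}_{\mu,\nu}=\sup_{r\ge1}\left[\left(\sum_{x=r}^{\infty}\mu(x)\right)\left(\sum_{x=1}^{r}\frac{1}{\nu(x)^{\frac1{p-1}}}\right)^{p-1}\right],\qquad B^{(2)}_{\mu,\nu}=\sup_{r\ge1}\left[\left(\sum_{x=1}^{r}\mu(x)\right)\left(\sum_{x=r+1}^{\infty}\frac{1}{\nu(x)^{\frac1{p-1}}}\right)^{p-1}\right].$$ If $\min(B^{(1)}_{\mu,\nu},B^{(2)}_{\mu,\nu})<\infty$, then $C^0_{\mu,\nu}<\infty$, and moreover $$C^0_{\mu,\nu}\le\frac{p^p}{(p-1)^{p-1}}\min\left(B^{(1)}_{\mu,\nu},B^{(2)}_{\mu,\nu}\right).$$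
   Context: $\mathbb{N}^*=\{1,2,3,\dots\}$. A positive measure $\mu$ on $\mathbb{N}^*$ is identified with its weights $\mu(n)\in(0,\infty)$, $n\ge1$. Sums of nonnegative terms take values in $[0,+\infty]$; the condition $\sum_{n=1}^\infty f(n)=0$ means that the series converges with sum $0$. *)

(* Defs.v *)
From HB Require Import structures.
From mathcomp Require Import all_boot all_order all_algebra.
From mathcomp Require Import all_classical all_reals all_analysis.

Set Implicit Arguments.
Unset Strict Implicit.
Unset Printing Implicit Defensive.

Import Order.TTheory GRing.Theory Num.Theory.
Import numFieldNormedType.Exports.

Local Open Scope classical_set_scope.
Local Open Scope ring_scope.
Local Open Scope ereal_scope.

(* Functions on {1, 2, 3, ...} are represented by functions on nat; every sum
   below starts at 1, so the value at 0 plays no role. *)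

Definition zero_sum_functions (R : realType) : set (nat -> R) :=
  [set f | (fun n : nat => (\sum_(1 <= k < n.+1) f k)%R) @ \oo --> (0 : R)%R].

Definition hardy_lhs (R : realType) (p : R) (mu f : nat -> R) : \bar R :=
  \sum_(1 <= x <oo)
    (`| (\sum_(1 <= y < x.+1) f y)%R | `^ p * mu x)%R%:E.

Definition hardy_rhs (R : realType) (p : R) (nu f : nat -> R) : \bar R :=
  \sum_(1 <= x <oo) (`| f x | `^ p * nu x)%R%:E.

(* In \bar R one has 0 * +oo = +oo * 0 = 0. The first product is excluded by
   0 < C; the second one only occurs if f vanishes on {1, 2, 3, ...}. *)
Definition hardy_admissible (R : realType) (p : R) (mu nu : nat -> R) :
    set (\bar R) :=
  [set C | 0 < C /\ forall f : nat -> R, zero_sum_functions f ->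
             hardy_lhs p mu f <= C * hardy_rhs p nu f].

(* This infimum is a minimum, see hardy_const_admissible. *)
Definition hardy_const (R : realType) (p : R) (mu nu : nat -> R) : \bar R :=
  ereal_inf (hardy_admissible p mu nu).

Definition hardy_B1 (R : realType) (p : R) (mu nu : nat -> R) : \bar R :=
  ereal_sup [set (\sum_(r <= x <oo) (mu x)%:E) *
                 (\sum_(1 <= x < r.+1) ((nu x `^ (p - 1)^-1)^-1)%R%:E)
                   `^ (p - 1)
            | r in [set r : nat | (1 <= r)%N]].

Definition hardy_B2 (R : realType) (p : R) (mu nu : nat -> R) : \bar R :=
  ereal_sup [set (\sum_(1 <= x < r.+1) (mu x)%:E) *
                 (\sum_(r.+1 <= x <oo) ((nu x `^ (p - 1)^-1)^-1)%R%:E)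
                   `^ (p - 1)
            | r in [set r : nat | (1 <= r)%N]].

Lemma hardy_const_le (R : realType) (p : R) (mu nu : nat -> R) (C : \bar R) :
  hardy_admissible p mu nu C -> hardy_const p mu nu <= C.
Proof. exact: ereal_inf_lbound. Qed.

Lemma hardy_rhs_ge0 (R : realType) (p : R) (nu f : nat -> R)
    (hnu : forall n : nat, (1 <= n)%N -> (0 < nu n)%R) :
  0 <= hardy_rhs p nu f.
Proof.
by apply: nneseries_ge0 => n n1 _; rewrite lee_fin mulr_ge0 ?powR_ge0// ltW// hnu.
Qed.

Lemma hardy_rhs_eq0 (R : realType) (p : R) (nu f : nat -> R) (hp : (1 < p)%R)
    (hnu : forall n : nat, (1 <= n)%N -> (0 < nu n)%R) :
  hardy_rhs p nu f = 0 -> forall n : nat, (1 <= n)%N -> f n = 0%R.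
Proof.
move=> h n n1.
have ge0 k : (1 <= k)%N -> xpredT k -> 0 <= (`|f k| `^ p * nu k)%R%:E :> \bar R.
  by move=> k1 _; rewrite lee_fin mulr_ge0 ?powR_ge0// ltW// hnu.
have := @nneseries_lim_ge R (fun x => (`|f x| `^ p * nu x)%R%:E) xpredT 1 n.+1 ge0.
rewrite -/(hardy_rhs p nu f) h big_nat_recr//= => le0.
have : (`|f n| `^ p * nu n)%R%:E <= 0 :> \bar R.
  apply: le_trans le0; rewrite leeDr// big_nat_cond sume_ge0// => i.
  by rewrite andbT => /andP[i1 _]; exact: ge0.
rewrite lee_fin pmulr_lle0 ?hnu// => H.
have /eqP : (`|f n| `^ p = 0)%R by apply/eqP; rewrite eq_le H powR_ge0.
by rewrite powR_eq0 normr_eq0 => /andP[/eqP].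
Qed.

Lemma hardy_lhs_eq0 (R : realType) (p : R) (mu f : nat -> R) (hp : (1 < p)%R) :
  (forall n : nat, (1 <= n)%N -> f n = 0%R) -> hardy_lhs p mu f = 0.
Proof.
move=> f0; rewrite /hardy_lhs eseries0// => i _ _.
rewrite big_nat_cond big1 => [|k]; last by rewrite andbT => /andP[/f0].
by rewrite normr0 powR0 ?mul0r// gt_eqF// (lt_trans ltr01).
Qed.

Lemma hardy_const_gt0 (R : realType) (p : R) (mu nu : nat -> R)
    (hp : (1 < p)%R)
    (hmu : forall n : nat, (1 <= n)%N -> (0 < mu n)%R)
    (hnu : forall n : nat, (1 <= n)%N -> (0 < nu n)%R) :
  0 < hardy_const p mu nu.
Proof.
have p0 : (p != 0)%R by rewrite gt_eqF// (lt_trans ltr01).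
pose f (n : nat) : R := ((n == 1)%:R - (n == 2)%:R)%R.
have S1 n : (2 <= n)%N -> (\sum_(1 <= k < n.+1) f k = 0)%R.
  elim: n => // n IH; rewrite leq_eqVlt => /orP[/eqP<-|].
    by rewrite unlock /= /f /= addr0 subr0 sub0r subrr.
  move=> n2; rewrite big_nat_recr//= IH// /f.
  by case: n n2 {IH} => [|[|n]]//= _; rewrite subrr addr0.
have Ff : zero_sum_functions f.
  apply: cvg_near_cst.
  by exists 2%N => // n /= n2; exact: S1.
have L : (mu 1%N)%:E <= hardy_lhs p mu f.
  have := @nneseries_lim_ge R
    (fun x => (`| \sum_(1 <= y < x.+1) f y | `^ p * mu x)%R%:E) xpredT 1 2.
  have f1 : f 1%N = 1%R by rewrite /f /= subr0.
  rewrite !big_nat1 f1 normr1 powR1 mul1r; apply.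
  by move=> k k1 _; rewrite lee_fin mulr_ge0 ?powR_ge0// ltW// hmu.
have N : hardy_rhs p nu f = (nu 1%N + nu 2%N)%:E.
  rewrite /hardy_rhs (nneseries_split 1 2); last first.
    by move=> k k1; rewrite lee_fin mulr_ge0 ?powR_ge0// ltW// hnu.
  rewrite [X in _ + X]eseries0 => [|[|[|[|i]]]//= _ _]; last first.
    by rewrite /f /= subrr normr0 powR0// mul0r.
  rewrite unlock /= /f /= subr0 sub0r normrN normr1 powR1 !mul1r.
  by rewrite !adde0.
have n0 : (0 < nu 1%N + nu 2%N)%R by rewrite addr_gt0// hnu.
apply: (@lt_le_trans _ _ ((mu 1%N) / (nu 1%N + nu 2%N))%:E).
  by rewrite lte_fin divr_gt0// hmu.
apply: le_ereal_inf_tmp => C [C0 /(_ _ Ff)]; rewrite N => h.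
by rewrite EFinM lee_pdivrMr//; exact: le_trans L h.
Qed.

Lemma hardy_const_admissible (R : realType) (p : R) (mu nu : nat -> R)
    (hp : (1 < p)%R)
    (hmu : forall n : nat, (1 <= n)%N -> (0 < mu n)%R)
    (hnu : forall n : nat, (1 <= n)%N -> (0 < nu n)%R) :
  hardy_admissible p mu nu (hardy_const p mu nu).
Proof.
have C0 := hardy_const_gt0 hp hmu hnu; split=> // f Ff.
have := hardy_rhs_ge0 p f hnu.
rewrite le_eqVlt => /orP[/eqP N0|].
  by rewrite -N0 mule0 (hardy_lhs_eq0 mu hp (hardy_rhs_eq0 hp hnu (esym N0))).
case E : (hardy_rhs p nu f) => [r| |]//; last by rewrite gt0_muley// leey.
rewrite lte_fin => r0; rewrite -lee_pdivrMr//.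
by apply: le_ereal_inf_tmp => C [_ /(_ _ Ff)]; rewrite E lee_pdivrMr.
Qed.

(* Main.v *)
Require Import Defs.
From HB Require Import structures.
From mathcomp Require Import all_boot all_order all_algebra.
From mathcomp Require Import all_classical all_reals all_analysis.
From mathcomp Require Import ring lra zify.

(** Both bounds reduce to one Hardy inequality for finite sums, proved as by
    Muckenhoupt. With s = nu^(-1/(p-1)), S_j = s_0 + ... + s_j, M_i the tail sums
    of mu and q = 1 - 1/p, Hoelder's inequality with weights s_j S_j^(q-1) gives
      (sum_(j <= i) a_j)^p
        <= (sum_(j <= i) a_j^p nu_j S_j^q) (sum_(j <= i) s_j S_j^(q-1))^(p-1).
    By concavity of t^q the last sum is at most S_i^q / q, and
    S_i^(p-1) <= b / M_i; after exchanging the sums, concavity of t^(1/p) yields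
    sum_(i >= j) mu_i M_i^(1/p-1) <= p M_j^(1/p), and S_j^q M_j^(1/p) <= b^(1/p).
    For the second constant, reversing the indices bounds the sums over y > x
    instead of y <= x; as f has sum zero, the partial sum up to x is the limit
    of minus the sums over x < y <= N. *)

Set Implicit Arguments.
Unset Strict Implicit.
Unset Printing Implicit Defensive.

Import Order.TTheory GRing.Theory Num.Theory.
Import numFieldNormedType.Exports.

Local Open Scope ring_scope.

(** * Power inequalities and sums of weights against powers of their partial sums *)

Section FiniteHardy.
Variable R : realType.
Implicit Types (p q x y c s : R).

(** For c > 0 this is Young's inequality for x / c and 1, with exponents p and its conjugate,
    multiplied by p c^p. *)
Lemma powR_tangent p c x : 1 < p -> 0 <= c -> 0 <= x ->
  c `^ p + p * c `^ (p - 1) * (x - c) <= x `^ p.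
Proof.
move=> p1; rewrite le_eqVlt => /predU1P[<- x0|c0 x0].
  have [p0 p10] : p != 0 /\ p - 1 != 0 by split; apply/eqP; lra.
  by rewrite !powR0// mulr0 mul0r addr0 powR_ge0.
have p0 : 0 < p by lra.
set y := x / c; have y0 : 0 <= y by rewrite divr_ge0// ltW.
have -> : x = y * c by rewrite /y divfK// gt_eqF.
have q0 : 0 < (1 - p^-1)^-1 by rewrite invr_gt0 subr_gt0 invf_lt1.
have := conjugate_powR y0 ler01 p0 q0.
rewrite invrK powR1 mulr1 mul1r addrC subrK => /(_ erefl) h.
rewrite powRM ?(ltW c0)// powRB ?implybT//; last first.
  by rewrite implybE gt_eqF ?orbT.
rewrite powRr1 ?(ltW c0)//.
have -> : c `^ p + p * (c `^ p / c) * (y * c - c) = c `^ p * (1 + p * (y - 1)).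
  by field; rewrite gt_eqF.
rewrite [leRHS]mulrC ler_wpM2l ?powR_ge0//.
have {}h : p * y <= p * (y `^ p / p + (1 - p^-1)) by rewrite ler_pM2l.
have e : p * (y `^ p / p + (1 - p^-1)) = y `^ p + (p - 1).
  by field; rewrite gt_eqF.
lra.
Qed.

(** Concavity of t^q: the secant slope on [x, x + s] is at least the derivative at the right end. It
    comes from Young's inequality for (x / t)^q and 1, with t = x + s and exponents 1/q and
    1/(1-q). *)
Lemma powR_secant q x s : 0 < q -> q < 1 -> 0 <= x -> 0 < s ->
  s * (x + s) `^ (q - 1) <= q^-1 * ((x + s) `^ q - x `^ q).
Proof.
move=> q0 q1 x0 s0; set t := x + s; have t0 : 0 < t by rewrite /t; lra.
have q'0 : 0 < q^-1 by rewrite invr_gt0.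
have u0 : 0 <= x / t by rewrite divr_ge0// ltW.
have r0 : 0 < (1 - q)^-1 by rewrite invr_gt0; lra.
have := conjugate_powR (powR_ge0 (x / t) q) ler01 q'0 r0.
rewrite !invrK powR1 mulr1 mul1r addrC subrK => /(_ erefl).
rewrite -powRrM divff ?gt_eqF// powRr1// => h.
have -> : x `^ q = (x / t) `^ q * t `^ q.
  by rewrite -powRM ?divfK ?gt_eqF// ltW.
rewrite powRB ?powRr1 ?(ltW t0)//; last by rewrite (gt_eqF t0) implybT.
rewrite mulrC ler_pdivlMl//.
have -> : q * (t `^ q / t * s) = t `^ q * (q * (1 - x / t)).
  have -> : s = t - x by rewrite /t; ring.
  by field; rewrite gt_eqF.
rewrite -{2}(mul1r (t `^ q)) -mulrBl mulrC ler_wpM2r ?powR_ge0//.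
lra.
Qed.

(** Discrete form of integrating S^(q-1) dS: by [powR_secant] each term is at most q^-1 times an
    increment of S^q, and the increments telescope. *)
Lemma sum_prefix_powR q (s : nat -> R) n : 0 < q -> q < 1 ->
  (forall i, (i < n)%N -> 0 < s i) ->
  \sum_(0 <= i < n) s i * (\sum_(0 <= j < i.+1) s j) `^ (q - 1) <=
  q^-1 * (\sum_(0 <= j < n) s j) `^ q.
Proof.
move=> q0 q1; elim: n => [|n IH] s0.
  by rewrite !big_geq// mulr_ge0 ?powR_ge0// invr_ge0 ltW.
rewrite big_nat_recr//=.
have /IH h : forall i, (i < n)%N -> 0 < s i by move=> i /ltnW; exact: s0.
have x0 : 0 <= \sum_(0 <= j < n) s j.
  by rewrite big_nat_cond sumr_ge0// => i /andP[/andP[_ /ltnW /s0 /ltW]].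
have := powR_secant q0 q1 x0 (s0 n (ltnSn n)).
rewrite -big_nat_recr//=; lra.
Qed.

Lemma sum_nat_rev (F : nat -> R) m n :
  \sum_(m <= j < n) F j = \sum_(0 <= j < n - m) F (n - j.+1)%N.
Proof.
rewrite big_nat_rev -{1}(add0n m) big_addn.
by apply: eq_bigr => i _; congr F; lia.
Qed.

Lemma sum_suffix_powR q (s : nat -> R) m n : 0 < q -> q < 1 ->
  (forall i, (m <= i < n)%N -> 0 < s i) ->
  \sum_(m <= i < n) s i * (\sum_(i <= j < n) s j) `^ (q - 1) <=
  q^-1 * (\sum_(m <= j < n) s j) `^ q.
Proof.
move=> q0 q1; have [nm|/ltnW mn] := leqP n m => s0.
  by rewrite !big_geq// mulr_ge0 ?powR_ge0// invr_ge0 ltW.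
rewrite [leLHS]sum_nat_rev [in leRHS]sum_nat_rev.
apply: le_trans (sum_prefix_powR q0 q1 _); last by move=> i ?; apply: s0; lia.
apply: ler_sum_nat => i /andP[_ im]; rewrite sum_nat_rev.
by have -> : (n - (n - i.+1) = i.+1)%N by lia.
Qed.

(* Hoelder's inequality, as the sum of the tangent inequalities for t^p at
   (sum a) / (sum w), evaluated at a_i / w_i with weights w_i. *)
Lemma powR_sum_le p (a w : nat -> R) n : 1 < p ->
  (forall i, (i <= n)%N -> 0 <= a i) -> (forall i, (i <= n)%N -> 0 < w i) ->
  (\sum_(0 <= i < n.+1) a i) `^ p <=
  (\sum_(0 <= i < n.+1) a i `^ p * w i `^ (1 - p)) *
  (\sum_(0 <= i < n.+1) w i) `^ (p - 1).
Proof.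
move=> p1 a0 w0; set A := \sum_(_ <= _ < _) a _; set W := \sum_(_ <= _ < _) w _.
have A0 : 0 <= A by rewrite /A big_nat sumr_ge0.
have W0 : 0 < W.
  rewrite /W big_nat_recr//= ltr_wpDl ?w0// big_nat sumr_ge0// => i /andP[_ ?].
  by rewrite ltW// w0// ltnW.
pose c := A / W; have c0 : 0 <= c by rewrite divr_ge0// ltW.
have -> : A `^ p = c `^ p * W * W `^ (p - 1).
  rewrite -mulrA powRB; last by rewrite (gt_eqF W0) implybT.
  rewrite powRr1 ?(ltW W0)// (mulrC W) divfK ?(gt_eqF W0)// -powRM ?(ltW W0)//.
  by rewrite divfK ?gt_eqF.
rewrite ler_wpM2r ?powR_ge0//.
have -> : c `^ p * W = \sum_(0 <= i < n.+1)
    w i * (c `^ p + p * c `^ (p - 1) * (a i / w i - c)).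
  rewrite (eq_big_nat _ _ (F2 := fun i => (c `^ p - p * c `^ (p - 1) * c) * w i +
     p * c `^ (p - 1) * a i)); last first.
    by move=> i /andP[_ ni]; field; rewrite gt_eqF// w0.
  rewrite big_split/= -!mulr_sumr -/A -/W.
  have -> : A = c * W by rewrite divfK// gt_eqF.
  by ring.
apply: ler_sum_nat => i /andP[_ ni]; have wi0 := w0 i ni.
rewrite [w i `^ _]powRB; last by rewrite (gt_eqF wi0) implybT.
rewrite powRr1 ?(ltW wi0)// mulrCA ler_wpM2l ?(ltW wi0)//.
apply: le_trans (powR_tangent p1 c0 (divr_ge0 (a0 i ni) (ltW wi0))) _.
rewrite powRM ?invr_ge0 ?(ltW wi0) ?a0// -powRN -powR_inv1 ?(ltW wi0)//.
by rewrite -powRrM mulN1r.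
Qed.

(** * Hardy's inequality for finite sums and its dual *)

Lemma exchange_big_triangular (F : nat -> nat -> R) n :
  \sum_(0 <= i < n) \sum_(0 <= j < i.+1) F i j =
  \sum_(0 <= j < n) \sum_(j <= i < n) F i j.
Proof.
under eq_big_nat => i /andP[_ ni] do rewrite (big_nat_widen _ _ n)//.
rewrite (exchange_big_dep_nat xpredT)//=; apply: eq_big_nat => j /andP[_ jn].
by rewrite [RHS](big_nat_widenl _ 0)//; apply: eq_bigl => i; lia.
Qed.

Lemma finite_hardy p b (mu nu a : nat -> R) n : 1 < p ->
  (forall i, (i < n)%N -> 0 < mu i) ->
  (forall i, (i < n)%N -> 0 < nu i) ->
  (forall i, (i < n)%N -> 0 <= a i) ->
  (forall i, (i < n)%N ->
     (\sum_(i <= k < n) mu k) *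
     (\sum_(0 <= j < i.+1) (nu j `^ (p - 1)^-1)^-1) `^ (p - 1) <= b) ->
  \sum_(0 <= i < n) (\sum_(0 <= j < i.+1) a j) `^ p * mu i <=
  p `^ p / (p - 1) `^ (p - 1) * b * \sum_(0 <= j < n) a j `^ p * nu j.
Proof.
move=> p1 mu0 nu0 a0 hb.
have [->|n0] := posnP n; first by rewrite !big_geq// mulr0.
have p0 : 0 < p by lra.
have p10 : 0 < p - 1 by lra.
(* With this exponent S^q = (S^(p-1))^(1/p), so the hypothesis on M_j S_j^(p-1) bounds S_j^q
   M_j^(1/p) by b^(1/p). *)
pose q := 1 - p^-1.
have r1 : p^-1 < 1 by rewrite invf_lt1.
have r0 : 0 < p^-1 by rewrite invr_gt0.
have q0 : 0 < q by rewrite /q; lra.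
have q1 : q < 1 by rewrite /q; lra.
pose s j := (nu j `^ (p - 1)^-1)^-1.
have s0 j : (j < n)%N -> 0 < s j.
  by move=> jn; rewrite invr_gt0 powR_gt0// nu0.
pose S i := \sum_(0 <= j < i.+1) s j.
pose M i := \sum_(i <= k < n) mu k.
have S0 i : (i < n)%N -> 0 < S i.
  move=> ni; rewrite /S big_nat_recr//= ltr_wpDl ?s0// big_nat sumr_ge0//.
  by move=> k /andP[_ ki]; rewrite ltW// s0// (ltn_trans ki).
have M0 i : (i < n)%N -> 0 < M i.
  move=> ni; rewrite /M big_ltn// ltr_pwDl ?mu0// big_nat sumr_ge0//.
  by move=> k /andP[_ kn]; rewrite ltW// mu0.
have {}hb i : (i < n)%N -> M i * S i `^ (p - 1) <= b by exact: hb.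
have b0 : 0 < b.
  by apply: lt_le_trans (hb 0%N n0); rewrite mulr_gt0 ?powR_gt0 ?S0 ?M0.
(* The second Hoelder factor is at most (S_i^q / q)^(p-1), that is, q^-(p-1) (S_i^(p-1))^q;
   inserting S_i^(p-1) <= b / M_i gives c M_i^(-q), where -q = 1/p - 1. *)
pose c := q^-1 `^ (p - 1) * b `^ q.
have c0 : 0 <= c by rewrite mulr_ge0 ?powR_ge0.
have row i : (i < n)%N -> (\sum_(0 <= j < i.+1) a j) `^ p * mu i <=
    \sum_(0 <= j < i.+1) c * (a j `^ p * nu j * S j `^ q) *
                          (mu i * M i `^ (p^-1 - 1)).
  move=> ni.
  have jn j : (j <= i)%N -> (j < n)%N by move=> ji; exact: leq_ltn_trans ni.
  pose w j := s j * S j `^ (q - 1).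
  have w0 j : (j <= i)%N -> 0 < w j.
    by move=> /jn ?; rewrite mulr_gt0 ?powR_gt0 ?s0 ?S0.
  have := powR_sum_le p1 (fun j ji => a0 j (jn j ji)) w0.
  (* Here s^(1-p) = nu, and (q-1)(1-p) = q. *)
  have -> : \sum_(0 <= j < i.+1) a j `^ p * w j `^ (1 - p) =
            \sum_(0 <= j < i.+1) a j `^ p * nu j * S j `^ q.
    apply: eq_big_nat => j /andP[_ /jn ?]; rewrite -mulrA; congr (_ * _).
    rewrite /w powRM ?powR_ge0 ?(ltW (s0 _ _))// -powRrM; congr (_ * _ `^ _).
      rewrite /s -powRN -powRrM.
      have -> : - (p - 1)^-1 * (1 - p) = 1 by field; rewrite gt_eqF.
      by rewrite powRr1// ltW// nu0.
    by rewrite /q; field; rewrite gt_eqF.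
  set D := \sum_(0 <= j < i.+1) _ * _ => h.
  have D0 : 0 <= D.
    rewrite /D big_nat sumr_ge0// => j /andP[_ /jn ?].
    by rewrite !mulr_ge0 ?powR_ge0// ltW// nu0.
  rewrite -mulr_suml -mulr_sumr -/D mulrA mulrAC ler_wpM2r ?(ltW (mu0 _ _))//.
  apply: le_trans h _; rewrite (mulrC c) -mulrA ler_wpM2l//.
  have W : \sum_(0 <= j < i.+1) w j <= q^-1 * S i `^ q.
    by apply: sum_prefix_powR => // j /jn; exact: s0.
  apply: le_trans (ge0_ler_powR (ltW p10) _ _ W) _; rewrite ?nnegrE.
  - by rewrite big_nat sumr_ge0// => j /andP[_ ji]; rewrite ltW// w0.
  - by rewrite mulr_ge0 ?powR_ge0// invr_ge0 ltW.
  rewrite powRM ?powR_ge0 ?invr_ge0 ?(ltW q0)// -mulrA ler_wpM2l ?powR_ge0//.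
  have -> : p^-1 - 1 = - q by rewrite /q; ring.
  rewrite powRN ler_pdivlMr ?powR_gt0 ?M0// powRAC.
  rewrite -powRM ?powR_ge0 ?(ltW (M0 _ _))//.
  apply: ge0_ler_powR; rewrite ?nnegrE ?(ltW q0) ?(ltW b0)//.
    by rewrite mulr_ge0 ?powR_ge0 ?(ltW (M0 _ _)).
  by rewrite mulrC hb.
apply: le_trans (ler_sum_nat (fun i h => row i (andP h).2)) _.
rewrite exchange_big_triangular mulr_sumr; apply: ler_sum_nat => j /andP[_ jn].
rewrite -mulr_sumr.
have := @sum_suffix_powR p^-1 mu j n r0 r1 (fun i h => mu0 i (andP h).2).
rewrite -/(M j) invrK => h.
have -> : p `^ p / (p - 1) `^ (p - 1) * b * (a j `^ p * nu j) =
    c * (a j `^ p * nu j) * (p * b `^ p^-1).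
  (* The constant has two sources: q^-(p-1) from the prefix sums of [s], and p from the suffix sums
     of [mu]. *)
  have -> : p `^ p / (p - 1) `^ (p - 1) = q^-1 `^ (p - 1) * p.
    have -> : q^-1 = p * (p - 1)^-1 by rewrite /q; field; rewrite !gt_eqF.
    rewrite powRM ?invr_ge0 ?(ltW p0) ?(ltW p10)//.
    rewrite [p `^ (p - 1)]powRB ?(gt_eqF p0) ?implybT// powRr1 ?(ltW p0)//.
    rewrite -(powR_inv1 (ltW p10)) powRAC powR_inv1 ?powR_ge0//.
    by field; rewrite !gt_eqF ?powR_gt0.
  have {1}-> : b = b `^ q * b `^ p^-1.
    rewrite -powRD ?(gt_eqF b0) ?implybT// /q subrK powRr1//.
    exact: ltW.
  by rewrite /c; ring.
rewrite mulrA -mulrA ler_wpM2l//.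
  by rewrite !mulr_ge0 ?powR_ge0 ?(ltW (nu0 _ _)).
apply: le_trans (ler_wpM2l (powR_ge0 _ _) h) _.
rewrite mulrCA ler_wpM2l ?(ltW p0)//.
have -> : q = (p - 1) * p^-1 by rewrite /q; field; rewrite gt_eqF.
rewrite powRrM -powRM ?powR_ge0 ?(ltW (M0 _ _))//.
apply: ge0_ler_powR; rewrite ?nnegrE ?(ltW r0) ?(ltW b0)//.
  by rewrite mulr_ge0 ?powR_ge0 ?(ltW (M0 _ _)).
by rewrite mulrC hb.
Qed.
(** Reversing the indices, i to n - i - 1 for [mu] and j to n - j for [nu] and [a], turns the sums
    over j > i into prefix sums, to which [finite_hardy] applies. *)
Lemma finite_hardy_dual p b (mu nu a : nat -> R) n : 1 < p ->
  (forall i, (i < n)%N -> 0 < mu i) ->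
  (forall i, (i <= n)%N -> 0 < nu i) ->
  (forall i, (i <= n)%N -> 0 <= a i) ->
  (forall i, (i < n)%N ->
     (\sum_(0 <= k < i.+1) mu k) *
     (\sum_(i.+1 <= j < n.+1) (nu j `^ (p - 1)^-1)^-1) `^ (p - 1) <= b) ->
  0 <= b ->
  \sum_(0 <= i < n) (\sum_(i.+1 <= j < n.+1) a j) `^ p * mu i <=
  p `^ p / (p - 1) `^ (p - 1) * b * \sum_(0 <= j < n.+1) a j `^ p * nu j.
Proof.
move=> p1 mu0 nu0 a0 hb b0.
have rev (F : nat -> R) i : (i < n)%N ->
    \sum_(0 <= j < i.+1) F (n - j)%N = \sum_(n - i <= j < n.+1) F j.
  move=> ni; rewrite [RHS]sum_nat_rev.
  have -> : (n.+1 - (n - i) = i.+1)%N by lia.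
  by apply: eq_bigr => j _; congr F; lia.
have P1 i : (i < n)%N -> 0 < mu (n - i.+1)%N by move=> ?; apply: mu0; lia.
have P2 i : (i < n)%N -> 0 < nu (n - i)%N by move=> ?; apply: nu0; lia.
have P3 i : (i < n)%N -> 0 <= a (n - i)%N by move=> ?; apply: a0; lia.
have P4 i : (i < n)%N -> (\sum_(i <= k < n) mu (n - k.+1)%N) *
    (\sum_(0 <= j < i.+1) (nu (n - j)%N `^ (p - 1)^-1)^-1) `^ (p - 1) <= b.
  move=> ni; rewrite (rev (fun j => (nu j `^ (p - 1)^-1)^-1))//.
  have -> : \sum_(i <= k < n) mu (n - k.+1)%N = \sum_(0 <= k < n - i) mu k.
    rewrite [LHS]sum_nat_rev.
    by apply: eq_big_nat => k ?; congr mu; lia.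
  have := hb (n - i.+1)%N; have -> : ((n - i.+1).+1 = n - i)%N by lia.
  by apply; lia.
have h := finite_hardy p1 P1 P2 P3 P4.
rewrite sum_nat_rev subn0; apply: le_trans (le_trans _ h) _.
  apply: ler_sum_nat => i /andP[_ ni]; rewrite rev//.
  by have -> : ((n - i.+1).+1 = n - i)%N by lia.
rewrite ler_wpM2l ?mulr_ge0 ?invr_ge0 ?powR_ge0//.
(* The reversed inequality only has the terms 1 <= j <= n on the right; the nonnegative term j = 0
   is added. *)
rewrite [leRHS]sum_nat_rev subn0 big_nat_recr//=.
by rewrite ler_wpDr ?mulr_ge0 ?powR_ge0// subnn ltW// nu0.
Qed.

End FiniteHardy.

Local Open Scope ereal_scope.

(** * Passage from finite sums to [hardy_const] *)

Section HardyConstant.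
Variables (R : realType) (p : R) (mu nu : nat -> R).
Hypothesis hp : (1 < p)%R.
Hypothesis hmu : forall n : nat, (1 <= n)%N -> (0 < mu n)%R.
Hypothesis hnu : forall n : nat, (1 <= n)%N -> (0 < nu n)%R.

Let K : R := (p `^ p / (p - 1) `^ (p - 1))%R.
Let s n : R := ((nu n `^ (p - 1)^-1)^-1)%R.

Let K_gt0 : (0 < K)%R.
Proof. by have := hp; rewrite /K => ?; rewrite divr_gt0// powR_gt0; lra. Qed.

Let s_gt0 n : (1 <= n)%N -> (0 < s n)%R.
Proof. by move=> n1; rewrite invr_gt0 powR_gt0// hnu. Qed.

(** [hardy_lhs] is the limit of its partial sums. Indices are shifted down by one to match the
    finite inequalities. *)
Lemma hardy_const_le_partial (C : R) : (0 < C)%R ->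
  (forall f n, zero_sum_functions f ->
    (\sum_(0 <= i < n)
       `|\sum_(0 <= j < i.+1) f j.+1| `^ p * mu i.+1)%R%:E <=
    C%:E * hardy_rhs p nu f) ->
  hardy_const p mu nu <= C%:E.
Proof.
move=> C0 hC; apply: hardy_const_le; split=> [|f Ff]; first by rewrite lte_fin.
apply: lime_le.
  apply: is_cvg_nneseries => i i1 _.
  by rewrite lee_fin mulr_ge0 ?powR_ge0// ltW// hmu.
apply: nearW => n; rewrite big_add1 sumEFin; apply: le_trans (hC f n.-1 Ff).
rewrite lee_fin le_eqVlt; apply/orP; left; apply/eqP.
by apply: eq_bigr => i _; rewrite big_add1.
Qed.

Lemma hardy_rhs_partial (f : nat -> R) n :
  (\sum_(0 <= j < n) `|f j.+1| `^ p * nu j.+1)%R%:E <= hardy_rhs p nu f.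
Proof.
have := @nneseries_lim_ge R (fun x => (`|f x| `^ p * nu x)%R%:E) xpredT 1 n.+1.
rewrite big_add1 sumEFin/=; apply => i i1 _.
by rewrite lee_fin mulr_ge0 ?powR_ge0// ltW// hnu.
Qed.

(** Cutting the tails of [mu] at n only lowers the products in the supremum, so [finite_hardy]
    applies to |f| with the same b for every n. *)
Lemma hardy_const_le_B1 : hardy_B1 p mu nu < +oo ->
  hardy_const p mu nu <= K%:E * hardy_B1 p mu nu.
Proof.
move=> Bfin.
have hB r n : (1 <= r)%N ->
    ((\sum_(r <= x < n) mu x) * (\sum_(1 <= x < r.+1) s x) `^ (p - 1))%R%:E <=
    hardy_B1 p mu nu.
  move=> r1; apply: le_trans (ereal_sup_ubound _); last by exists r.
  rewrite sumEFin poweR_EFin EFinM lee_wpmul2r ?lee_fin ?powR_ge0//.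
  rewrite -sumEFin; apply: nneseries_lim_ge => i ri _.
  by rewrite lee_fin ltW// hmu// (leq_trans r1).
have B0 : 0 < hardy_B1 p mu nu.
  apply: lt_le_trans (hB 1%N 2%N isT); rewrite !big_nat1 lte_fin.
  by rewrite mulr_gt0 ?powR_gt0 ?hmu ?s_gt0.
case: (hardy_B1 p mu nu) Bfin B0 hB => [b| |]// _; rewrite lte_fin => b0 hB.
rewrite -EFinM; apply: hardy_const_le_partial => [|f n _].
  by rewrite mulr_gt0.
apply: le_trans (_ : (K * b)%:E *
    (\sum_(0 <= j < n) `|f j.+1| `^ p * nu j.+1)%R%:E <= _); last first.
  by rewrite lee_wpmul2l ?hardy_rhs_partial// lee_fin ltW// mulr_gt0.
rewrite -EFinM lee_fin.
have h := @finite_hardy R p b (fun i => mu i.+1) (fun i => nu i.+1)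
  (fun j => `|f j.+1|%R) n hp (fun i _ => hmu (ltn0Sn i))
  (fun i _ => hnu (ltn0Sn i)) (fun i _ => normr_ge0 _).
apply: le_trans (le_trans _ (h _)) _ => //.
  apply: ler_sum_nat => i _; rewrite ler_wpM2r ?(ltW (hmu _))//.
  rewrite ge0_ler_powR ?nnegrE ?sumr_ge0 ?ler_norm_sum//.
  by rewrite (le_trans ler01) ?(ltW hp).
by move=> i ni; have := hB i.+1 n.+1 isT; rewrite lee_fin !big_add1.
Qed.

(** Finite tails of [s] lie below the infinite ones, so [finite_hardy_dual] holds with the same b
    for every N; this allows N to tend to infinity while n is fixed. *)
Lemma hardy_const_le_B2 : hardy_B2 p mu nu < +oo ->
  hardy_const p mu nu <= K%:E * hardy_B2 p mu nu.
Proof.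
move=> Bfin.
have p10 : (0 < p - 1)%R by rewrite subr_gt0.
have p0 : (0 < p)%R by rewrite (lt_trans ltr01).
have hB r n : (1 <= r)%N ->
    ((\sum_(1 <= x < r.+1) mu x) * (\sum_(r.+1 <= x < n) s x) `^ (p - 1))%R%:E <=
    hardy_B2 p mu nu.
  move=> r1; apply: le_trans (ereal_sup_ubound _); last by exists r.
  rewrite sumEFin EFinM lee_wpmul2l//.
    by rewrite lee_fin big_nat sumr_ge0// => i /andP[? _]; rewrite ltW// hmu.
  have s0 i : (r.+1 <= i)%N -> (0 <= s i)%R.
    by move=> ri; rewrite ltW// s_gt0// (leq_trans _ ri).
  rewrite -poweR_EFin; apply: gt0_ler_poweR; first exact: ltW.
  - rewrite in_itv/= leey andbT lee_fin big_nat sumr_ge0// => i /andP[? _].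
    exact: s0.
  - rewrite in_itv/= leey andbT; apply: nneseries_ge0 => i ri _.
    by rewrite lee_fin s0.
  - rewrite -sumEFin; apply: nneseries_lim_ge => i ri _.
    by rewrite lee_fin s0.
(* An admissible constant has to be positive. Cutting at 3 leaves the single term x = 2 in the tail
   for r = 1. *)
have B0 : 0 < hardy_B2 p mu nu.
  apply: lt_le_trans (hB 1%N 3%N isT); rewrite !big_nat1 lte_fin.
  by rewrite mulr_gt0 ?powR_gt0 ?hmu ?s_gt0.
case: (hardy_B2 p mu nu) Bfin B0 hB => [b| |]// _; rewrite lte_fin => b0 hB.
have Kb0 : (0 < K * b)%R by rewrite mulr_gt0.
rewrite -EFinM; apply: hardy_const_le_partial => // f n Ff.
have := hardy_rhs_partial f; have := hardy_rhs_ge0 p f hnu.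
case: (hardy_rhs p nu f) => [r| |]//; last by rewrite gt0_muley ?leey.
rewrite lee_fin => r0 hr; rewrite -EFinM lee_fin.
pose F i := (\sum_(0 <= j < i.+1) f j.+1)%R.
pose D := (\sum_(0 <= i < n) p * `|F i| `^ (p - 1) * mu i.+1)%R.
(* The tangent inequality replaces continuity of t^p when N goes to infinity:
   the lower bound is affine in |F N|. *)
have bound N : (n <= N)%N ->
    (\sum_(0 <= i < n) `|F i| `^ p * mu i.+1 - `|F N| * D <= K * b * r)%R.
  move=> nN.
  have H := finite_hardy_dual (mu := fun i => mu i.+1) (nu := fun i => nu i.+1)
    (a := fun j => `|f j.+1|%R) hp (fun i _ => hmu (ltn0Sn i))
    (fun i _ => hnu (ltn0Sn i)) (fun i _ => normr_ge0 _).
  have {}H := H b N _ (ltW b0).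
  apply: le_trans (le_trans _ (H _)) _; last 2 first.
  - move=> i iN; have := hB i.+1 N.+2 isT.
    by rewrite lee_fin !big_add1.
  - by rewrite ler_wpM2l ?(ltW Kb0)// -lee_fin.
  (* Only the first n of the N rows are kept, so that [D] does not depend on N. *)
  rewrite [leRHS](big_cat_nat (n := n))//= ler_wpDr//.
    by apply: sumr_ge0 => i _; rewrite mulr_ge0 ?powR_ge0// ltW// hmu.
  rewrite mulr_sumr -sumrB; apply: ler_sum_nat => i /andP[_ ni].
  rewrite mulrA -mulrBl ler_wpM2r ?(ltW (hmu _))//.
  (* The tangent at |F i| is evaluated at the sum of the |f j.+1| over i < j <= N, which is at least
     |F i| - |F N|. *)
  apply: le_trans (powR_tangent hp (normr_ge0 (F i)) _); last exact: sumr_ge0.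
  rewrite lerD2l -mulNr [leLHS]mulrC ler_wpM2l ?mulr_ge0 ?powR_ge0 ?(ltW p0)//.
  rewrite lerNl opprB lerBlDr.
  have -> : F i = (F N - \sum_(i.+1 <= j < N.+1) f j.+1)%R.
    have iN : (i < N.+1)%N by rewrite ltnS ltnW// (leq_trans ni).
    by rewrite /F [in X in (X - _)%R](big_cat_nat (n := i.+1))//= addrK.
  by apply: le_trans (ler_normB _ _) _; rewrite lerD2l ler_norm_sum.
pose A := (\sum_(0 <= i < n) `|F i| `^ p * mu i.+1)%R.
(* The condition that f has sum zero enters here: it makes the error |F N| D vanish in the limit. *)
have F0 : ((fun N => F N) @ \oo --> (0 : R)%R)%classic.
  have := Ff; rewrite /zero_sum_functions/= -(cvg_shiftS _).
  rewrite (_ : (fun n => _) = F)//.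
  by apply/funext => N; rewrite big_add1.
have lim : ((fun N => A - `|F N| * D)%R @ \oo --> A)%classic.
  rewrite -[X in (_ --> X)%classic]subr0 -[X in (A - X)%R](mul0r D).
  apply: cvgB; first exact: cvg_cst.
  apply: cvgM; last exact: cvg_cst.
  by rewrite -(normr0 R); exact: cvg_norm.
apply: (cvgr_to_le lim); near=> N; apply: bound; near: N.
exact: nbhs_infty_ge.
Unshelve. all: by end_near.
Qed.

End HardyConstant.

(** * The bound by the smaller of the two quantities *)

Theorem proposition2p3 (R : realType) (p : R) (mu nu : nat -> R)
    (hp : (1 < p)%R)
    (hmu : forall n : nat, (1 <= n)%N -> (0 < mu n)%R)
    (hnu : forall n : nat, (1 <= n)%N -> (0 < nu n)%R)
    (hB : Order.min (hardy_B1 p mu nu) (hardy_B2 p mu nu) < +oo) :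
  hardy_const p mu nu < +oo /\
  hardy_const p mu nu <=
    (p `^ p / (p - 1) `^ (p - 1))%R%:E *
    Order.min (hardy_B1 p mu nu) (hardy_B2 p mu nu).
Proof.
have bound : hardy_const p mu nu <= (p `^ p / (p - 1) `^ (p - 1))%R%:E *
    Order.min (hardy_B1 p mu nu) (hardy_B2 p mu nu).
  by move: hB; rewrite /Order.min; case: ifPn => _;
    [exact: hardy_const_le_B1 | exact: hardy_const_le_B2].
split=> //; apply: le_lt_trans bound _.
by apply: lte_mul_pinfty => //; rewrite lee_fin mulr_ge0 ?invr_ge0 ?powR_ge0.
Qed.
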